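(* For all integers $\alpha\ge 1$ and $n\ge 0$, $$\overline{pp}(5^\alpha(5n+2))\equiv 0\pmod 5\quad\text{and}\quad \overline{pp}(5^\alpha(5n+3))\equiv 0\pmod 5.$$
   Context: For $|q|<1$, $(a;q)_\infty=\prod_{k=1}^\infty(1-aq^{k-1})$. An overpartition of $n$ is a partition of $n$ in which the first occurrence of each number may be overlined; there is exactly one overpartition of $0$ (the empty one). An overpartition pair of $n$ is an ordered pair $(\lambda,\mu)$ of overpartitions such that the sum of all parts of $\lambda$ and $\mu$ is $n$ (either may be the overpartition of $0$). $\overline{pp}(n)$ denotes the number of overpartition pairs of $n$; its generating function is $\sum_{n\ge 0}\overline{pp}(n)q^n=(-q;q)_\infty^2/(q;q)_\infty^2$. *)

(* Defs.v *)
From mathcomp Require Import all_boot.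

Set Implicit Arguments.
Unset Strict Implicit.
Unset Printing Implicit Defensive.

(* The pair (k, b) is a part equal to k, overlined iff b is true; parts are
   listed in weakly decreasing order. In the last clause, a part equal to an
   earlier one is not the first occurrence of its value. *)
Definition overpartition (s : seq (nat * bool)) : bool :=
  [&& all (fun x => 0 < x.1) s,
      sorted geq [seq x.1 | x <- s] &
      pairwise (fun x y => (x.1 == y.1) ==> ~~ y.2) s].

Definition weight (s : seq (nat * bool)) : nat := sumn [seq x.1 | x <- s].

Definition overpartition_pair (n : nat)
    (p : seq (nat * bool) * seq (nat * bool)) : bool :=
  [&& overpartition p.1, overpartition p.2 & weight p.1 + weight p.2 == n].

(* In an overpartition pair of n, each component has at most n parts, all of
   them at most n (see overpartition_pair_bounded below), so all such pairs
   come from the following finite type. *)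
Definition bounded_seq (n : nat) : finType :=
  n.-bseq ('I_n.+1 * bool)%type.

Definition parts_of n (s : bounded_seq n) : seq (nat * bool) :=
  [seq (val x.1, x.2) | x <- (s : n.-bseq _)].

Definition pp (n : nat) : nat :=
  #|[set p : bounded_seq n * bounded_seq n |
      overpartition_pair n (parts_of p.1, parts_of p.2)]|.

Lemma parts_of_inj n : injective (@parts_of n).
Proof.
move=> s t /inj_map st; apply/val_inj/st => -[i b] [j c] /= [ij ->].
by rewrite (val_inj ij).
Qed.

Lemma overpartition_bounded n s : overpartition s -> weight s <= n ->
  exists t : bounded_seq n, parts_of t = s.
Proof.
case/and3P => pos _ _ le_n.
have szs : size s <= n.
  apply: leq_trans le_n; rewrite /weight.
  elim: s pos => //= x s IHs /andP[x_gt0 /IHs szs].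
  by rewrite -add1n leq_add.
have part_le x : x \in s -> x.1 <= n.
  move=> xs; apply: leq_trans le_n; rewrite /weight.
  elim: s xs {pos szs} => //= y s IHs; rewrite inE => /predU1P[-> | /IHs].
    exact: leq_addr.
  by move/leq_trans; apply; apply: leq_addl.
have szt : size [seq (inord x.1 : 'I_n.+1, x.2) | x <- s] <= n.
  by rewrite size_map.
exists (Bseq szt); rewrite /parts_of /= -map_comp -[RHS]map_id.
by apply/eq_in_map => -[k b] /part_le kn /=; rewrite inordK.
Qed.

Lemma overpartition_pair_bounded n s t : overpartition_pair n (s, t) ->
  exists p : bounded_seq n * bounded_seq n,
    (parts_of p.1, parts_of p.2) = (s, t).
Proof.
case/and3P => /= os ot /eqP st.
have [|u us] := overpartition_bounded (n := n) os; first by rewrite -st leq_addr.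
have [|v vt] := overpartition_bounded (n := n) ot; first by rewrite -st leq_addl.
by exists (u, v); rewrite /= us vt.
Qed.

(* Main.v *)
Require Import Defs.
From mathcomp Require Import all_boot.
From mathcomp Require Import all_order all_algebra.
From mathcomp Require Import zify ring.

Set Implicit Arguments.
Unset Strict Implicit.
Unset Printing Implicit Defensive.

Import GRing.Theory.

(** Write T = sum over x in Z of (-1)^x q^(x^2) and A for the generating
    function of overpartitions, so that A^2 is that of overpartition pairs.

    Gauss's identity says A T = 1 ([overpartition_gf_theta]).  Modulo 5, the
    Frobenius gives T^5 = T(q^5), hence A^2 T(q^5) = A^2 T^5 = T^3.  Let U
    be the operator that keeps the coefficients of index divisible by 5; it
    is linear over series in q^5, so U(A^2) T = U(T^3).

    The sign (-1)^x is (-1)^(x^2), so the n-th coefficient of U(T^3) is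
    (-1)^n times the number of integer points of x^2 + y^2 + z^2 = 5n.  The
    isotropic vectors of x^2 + y^2 + z^2 over F_5 form six lines, permuted
    transitively by permutations of the coordinates.  The points over the line
    spanned by (0, 1, 2) are the (5c, a + 2b, 2a - b), of norm
    5 (a^2 + b^2 + 5c^2).  A point lies over exactly one line, or over all
    six when it is divisible by 5, and 6 = 1 modulo 5: the number of points
    is thus congruent to that of a^2 + b^2 + 5c^2 = n
    ([size_solutions111_mod5]).  In other words U(T^3) = T^2 T(q^5), and so
    U(A^2) = T T(q^5), that is
      pp (5n) = (-1)^n #{(x, y) : x^2 + 5y^2 = n}   modulo 5   ([pp5]).

    The count on the right is unchanged when n is multiplied by 5
    ([reps15_mul5]), and it vanishes when n is 2 or 3 modulo 5, since neither
    is a square ([reps15_nonresidue]).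

    Gauss's identity follows from a finite version of it,
    [finite_gauss_identity], and from the product formula for A, obtained by
    removing one largest part ([agree_overparts_leS]). *)

(** * Polynomials as truncated power series *)

Section TruncatedSeries.
Local Open Scope ring_scope.
Variable R : comNzRingType.
Implicit Types p q r : {poly R}.

(** Congruence modulo X^M: polynomials stand for power series known up to
    order M. *)
Definition agree M p q := forall i, (i < M)%N -> p`_i = q`_i.

Lemma agree_refl M p : agree M p p. Proof. by []. Qed.

Lemma agree_sym M p q : agree M p q -> agree M q p.
Proof. by move=> pq i iM; rewrite pq. Qed.

Lemma agree_trans M q p r : agree M p q -> agree M q r -> agree M p r.
Proof. by move=> pq qr i iM; rewrite pq // qr. Qed.

Lemma agree_weaken M N p q : (N <= M)%N -> agree M p q -> agree N p q.
Proof. by move=> NM pq i iN; apply/pq/(leq_trans iN). Qed.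

Lemma agreeM M p q p' q' :
  agree M p q -> agree M p' q' -> agree M (p * p') (q * q').
Proof.
move=> pq pq' i iM; rewrite !coefM; apply: eq_bigr => j _.
by rewrite pq ?pq' //; apply: leq_ltn_trans iM; rewrite ?leq_subr // -ltnS.
Qed.

Lemma agreeMl M r p q : agree M p q -> agree M (r * p) (r * q).
Proof. exact/agreeM/agree_refl. Qed.

Lemma agreeMr M r p q : agree M p q -> agree M (p * r) (q * r).
Proof. by move=> pq; apply/agreeM/agree_refl. Qed.

Lemma agreeXn M k p : (M <= k)%N -> agree M ('X^k * p) 0.
Proof.
by move=> Mk i iM; rewrite coefXnM coef0 (leq_trans iM Mk).
Qed.

(** A series with constant term 1 is invertible. *)
Lemma agree_cancel M r p q :
  r`_0 = 1 -> agree M (r * p) (r * q) -> agree M p q.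
Proof.
move=> r0 rpq; elim/ltn_ind => i IH iM; have := rpq i iM.
rewrite !coefM !big_ord_recl !subn0 r0 !mul1r.
rewrite (eq_bigr (fun j : 'I_i => r`_(lift ord0 j) * q`_(i - lift ord0 j))).
  exact: addIr.
move=> j _; have ji := ltn_ord j; rewrite lift0 IH //; lia.
Qed.

End TruncatedSeries.

(** * Gauss's identity for the theta series *)

Section Gauss.
Local Open Scope ring_scope.
Variable R : comNzRingType.

Definition overlined_prod n := \prod_(1 <= k < n.+1) (1 + 'X^k) : {poly R}.
Definition plain_prod n := \prod_(1 <= k < n.+1) (1 - 'X^k) : {poly R}.
Definition theta_sum n :=
  1 + \sum_(1 <= j < n.+1) (-1) ^+ j * 'X^(j ^ 2) *+ 2 : {poly R}.

(** In the notation (a)_n of q-Pochhammer symbols of base X, this is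
    (-1)^j X^(j(n+1)) (-1)_j (X)_n / (X)_j, with the division carried out so
    as to stay among polynomials. *)
Definition finite_gauss_term n j : {poly R} :=
  (-1) ^+ j * 'X^(j * n.+1) *
  ((\prod_(0 <= k < j) (1 + 'X^k)) * \prod_(j.+1 <= k < n.+1) (1 - 'X^k)).

Lemma prod_1X n : \prod_(0 <= k < n.+1) (1 + 'X^k) = overlined_prod n *+ 2.
Proof. by rewrite big_ltn // expr0 -mulr2n mulr_natl. Qed.

(** The term j = 0 is [plain_prod n] and all the others are divisible by
    X^(n+1), so Gauss's identity appears as n grows.  In the induction, the
    j-th term at n + 1 minus 1 + X^(n+1) times the j-th term at n has the
    form (-1)^(j+1) (c_j + c_(j+1)), whose sum telescopes. *)
Lemma finite_gauss_identity n :
  overlined_prod n * theta_sum n = \sum_(0 <= j < n.+1) finite_gauss_term n j.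
Proof.
elim: n => [|n IH].
  rewrite /overlined_prod /theta_sum /finite_gauss_term big_nat1 !big_geq //.
  by rewrite expr0 mul0n expr0 addr0 !mulr1.
(* c 0 vanishes because of the factor 1 - X^0, and c n.+1 is, up to sign,
   the new term of the theta sum times overlined_prod n. *)
pose c j : {poly R} := (\prod_(0 <= k < j) (1 + 'X^k)) *
  \prod_(j <= k < n.+1) (1 - 'X^k) * 'X^(j * n.+1).
have c0 : c 0%N = 0.
  rewrite /c (@big_ltn _ _ _ 0 n.+1) //.
  by rewrite expr0 subrr mul0r mulr0 mul0r.
have tele m : \sum_(0 <= j < m) (-1) ^+ j.+1 * (c j + c j.+1) = (-1) ^+ m * c m.
  elim: m => [|m IHm]; first by rewrite big_geq // c0 mulr0.
  by rewrite big_nat_recr //= IHm !exprS; ring.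
have step j : (j < n.+1)%N ->
    finite_gauss_term n.+1 j = (1 + 'X^(n.+1)) * finite_gauss_term n j
      + (-1) ^+ j.+1 * (c j + c j.+1).
  move=> jn; rewrite /finite_gauss_term /c.
  rewrite [X in _ * (_ * X)](@big_cat_nat _ _ _ n.+1) //= big_nat1.
  rewrite (big_ltn jn) (@big_nat_recr _ _ _ j) //=.
  rewrite (mulnS j n.+1) mulSn !exprD [(-1) ^+ j.+1]exprS; ring.
rewrite big_nat_recr //= (eq_big_nat _ _ (fun j _ => step j _)) //.
rewrite big_split /= -big_distrr /= -IH tele /finite_gauss_term /c.
rewrite [\prod_(n.+2 <= k < _) _]big_geq // [\prod_(n.+1 <= k < _) _]big_geq //.
rewrite /theta_sum [in LHS](@big_nat_recr _ _ _ n.+1) //= addrA mulrDr.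
rewrite {1}/overlined_prod (@big_nat_recr _ _ _ n.+1) //=.
rewrite prod_1X -!/(overlined_prod _) (mulnS n.+1 n.+1) exprD -mulnn !mulr1.
rewrite /overlined_prod (@big_nat_recr _ _ _ n.+1) //=.
ring.
Qed.

Lemma agree_gauss n : agree n.+1 (overlined_prod n * theta_sum n) (plain_prod n).
Proof.
rewrite finite_gauss_identity big_ltn // {1}/finite_gauss_term big_geq //.
rewrite mul0n !expr0 !mul1r.
rewrite -[X in agree _ _ X]addr0 => i iM; rewrite !coefD; congr (_ + _).
rewrite coef_sum coef0 big_nat big1 // => j /andP[j0 _].
rewrite /finite_gauss_term [_ ^+ j * _]mulrC -mulrA (agreeXn _ _ iM) ?coef0 //.
by rewrite leq_pmull.
Qed.

End Gauss.

(** * Overpartitions by largest part *)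

Section Enumeration.

Definition overparts n : seq (seq (nat * bool)) :=
  [seq parts_of s | s in [pred s : bounded_seq n
     | overpartition (parts_of s) && (weight (parts_of s) == n)]].

Lemma mem_overparts n s : (s \in overparts n) = overpartition s && (weight s == n).
Proof.
apply/imageP/andP => [[t /andP[ot wt] ->] // | [os /eqP ws]].
have [|t ts] := overpartition_bounded (n := n) os; first by rewrite ws.
by exists t; rewrite // inE ts os ws /=.
Qed.

Lemma overparts_uniq n : uniq (overparts n).
Proof. by rewrite map_inj_uniq ?enum_uniq //; apply: parts_of_inj. Qed.

Lemma card_bounded_overpartitions n i : i <= n ->
  #|[set s : bounded_seq n | overpartition (parts_of s)
      && (weight (parts_of s) == i)]| = size (overparts i).
Proof.
move=> i_n; rewrite cardE -(size_map (@parts_of n)).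
apply/perm_size/uniq_perm; rewrite ?overparts_uniq //.
  by rewrite map_inj_uniq ?enum_uniq //; apply: parts_of_inj.
move=> s; rewrite mem_overparts; apply/mapP/andP => [[t] | [os /eqP ws]].
  by rewrite mem_enum inE => /andP[ot wt] ->.
have [|t ts] := overpartition_bounded (n := n) os; first by rewrite ws.
by exists t; rewrite // mem_enum inE ts os ws /=.
Qed.

Lemma pp_conv n :
  pp n = \sum_(i < n.+1) size (overparts i) * size (overparts (n - i)).
Proof.
rewrite /pp -sum1_card.
rewrite (partition_big (fun p => inord (weight (parts_of p.1)) : 'I_n.+1) predT) //=.
apply: eq_bigr => i _; have i_n : i <= n by rewrite -ltnS.
rewrite -(card_bounded_overpartitions i_n).
rewrite -(card_bounded_overpartitions (leq_subr i n)) -cardsX -sum1_card.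
apply: eq_bigl => -[s t]; rewrite !inE /overpartition_pair /=.
apply/andP/andP => [[/and3P[-> -> /eqP st] /eqP <-] | ]; last first.
  case=> /andP[-> /eqP ws] /andP[-> /eqP wt].
  by rewrite ws wt subnKC // eqxx inord_val.
by rewrite inordK /=; last lia; split; apply/eqP; lia.
Qed.

Lemma overpartition_cons x s : overpartition (x :: s) =
  [&& 0 < x.1, all (fun y => y.1 <= x.1) s, all (fun y => (x.1 == y.1) ==> ~~ y.2) s
    & overpartition s].
Proof.
rewrite /overpartition /= path_sortedE; last by move=> a b c; rewrite /geq /=; lia.
rewrite all_map; case: (0 < x.1) => //=.
case: (all _ s) => //=; case: (all _ s) => //=; case: (all _ s) => //=.
all: by rewrite ?andbF ?andbT.
Qed.

Definition overparts_le m n :=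
  [seq s <- overparts n | all (fun x => x.1 <= m) s].

(** What may follow a first part equal to m: further parts equal to m are not
    overlined. *)
Definition plain_overparts_le m n :=
  [seq s <- overparts_le m n | (m, true) \notin s].

Lemma mem_overparts_le m n s : (s \in overparts_le m n) =
  [&& overpartition s, weight s == n & all (fun x => x.1 <= m) s].
Proof. by rewrite mem_filter mem_overparts andbC andbA. Qed.

Lemma mem_plain_overparts_le m n s : (s \in plain_overparts_le m n) =
  [&& (m, true) \notin s, overpartition s, weight s == n
    & all (fun x => x.1 <= m) s].
Proof. by rewrite mem_filter mem_overparts_le. Qed.

Lemma overparts_le_uniq m n : uniq (overparts_le m n).
Proof. exact/filter_uniq/overparts_uniq. Qed.

Lemma plain_overparts_le_uniq m n : uniq (plain_overparts_le m n).
Proof. exact/filter_uniq/overparts_le_uniq. Qed.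

Lemma overparts_le_cons m n b t :
  ((m.+1, b) :: t \in overparts_le m.+1 n) =
  (m < n) && (t \in plain_overparts_le m.+1 (n - m.+1)).
Proof.
rewrite mem_plain_overparts_le mem_overparts_le overpartition_cons /= leqnn /=.
have -> : weight ((m.+1, b) :: t) = m.+1 + weight t by [].
have -> : all (fun y => (m.+1 == y.1) ==> ~~ y.2) t = ((m.+1, true) \notin t).
  apply/allP/idP => [no | no y yt]; first by apply/negP=> /no; rewrite eqxx.
  apply/implyP => /eqP ym; apply: contraNN no => y2.
  by rewrite ym; case: y y2 {ym} yt => k [].
case: (all _ t); case: (_ \notin t); case: (overpartition t) => //=; rewrite ?andbF //.
by rewrite !andbT; apply/eqP/andP => [|[mn /eqP]]; first split; try apply/eqP; lia.
Qed.

Lemma overparts_leS m n s : s \in overparts_le m.+1 n ->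
  s \notin overparts_le m n -> exists b t, s = (m.+1, b) :: t.
Proof.
rewrite !mem_overparts_le => /and3P[os -> all_m1]; rewrite os /=.
case: s os all_m1 => // -[k b] t; rewrite overpartition_cons /=.
case/and4P=> _ all_k _ _ /andP[km _]; rewrite negb_and => not_m.
suff -> : k = m.+1 by exists b, t.
apply/eqP; rewrite eqn_leq km ltnNge; apply/negP => k_m; move: not_m.
rewrite k_m /= => /negP; apply; apply: sub_all all_k => y /=.
by move/leq_trans; apply.
Qed.

Lemma overparts_le_sub m n : {subset overparts_le m n <= overparts_le m.+1 n}.
Proof.
move=> s; rewrite !mem_overparts_le => /and3P[-> -> le_m] /=.
by apply: sub_all le_m => x; apply: leqW.
Qed.

Lemma overparts_le_notin m n b t : ((m.+1, b) :: t \in overparts_le m n) = false.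
Proof. by rewrite mem_overparts_le /= ltnn !andbF. Qed.

Lemma map_cons_uniq (T : eqType) (x : T) ss : uniq ss -> uniq (map (cons x) ss).
Proof. by move=> ss_uniq; rewrite map_inj_uniq // => s t []. Qed.

Lemma mem_map_cons (T : eqType) (x y : T) s ss :
  (y :: s \in map (cons x) ss) = (y == x) && (s \in ss).
Proof.
apply/mapP/andP => [[t tss [-> ->]] | [/eqP-> sss]]; first by rewrite eqxx.
by exists s.
Qed.

(** The overpartitions of n with largest part m + 1, stripped of their first
    part; the test excludes the truncated difference when n < m + 1. *)
Definition tails m n :=
  if m < n then plain_overparts_le m.+1 (n - m.+1) else [::].

Lemma mem_tails m n t :
  (t \in tails m n) = (m < n) && (t \in plain_overparts_le m.+1 (n - m.+1)).
Proof. by rewrite /tails; case: ifP; rewrite ?in_nil. Qed.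

Lemma tails_uniq m n : uniq (tails m n).
Proof. by rewrite /tails; case: ifP; rewrite ?plain_overparts_le_uniq. Qed.

Lemma size_tails m n : size (tails m n) =
  if m < n then size (plain_overparts_le m.+1 (n - m.+1)) else 0.
Proof. by rewrite /tails; case: ifP. Qed.

(** A part m + 1 at the head cannot be overlined. *)
Lemma size_plain_overparts_le m n :
  size (plain_overparts_le m.+1 n) = size (overparts_le m n) + size (tails m n).
Proof.
rewrite -(size_map (cons (m.+1, false)) (tails m n)) -size_cat.
apply/perm_size/uniq_perm; first exact: plain_overparts_le_uniq.
  rewrite cat_uniq overparts_le_uniq map_cons_uniq ?tails_uniq // andbT /=.
  by apply/hasPn => _ /mapP[t _ ->]; rewrite overparts_le_notin.
move=> s; rewrite mem_cat.
have [sm | sm] := boolP (s \in overparts_le m n).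
  rewrite mem_filter overparts_le_sub // andbT /=.
  move: sm; rewrite mem_overparts_le => /and3P[_ _ /allP le_m].
  by apply/negP=> /le_m /=; lia.
rewrite mem_filter /=; apply/andP/idP => [[no sm1] | /mapP[t tt ->]].
  have [b [t st]] := overparts_leS sm1 sm; move: no sm1.
  rewrite st inE overparts_le_cons -mem_tails mem_map_cons => no ->.
  by rewrite andbT; case: b {st} no => //=; rewrite eqxx.
rewrite overparts_le_cons -mem_tails; split=> //.
move: tt; rewrite mem_tails mem_plain_overparts_le => /and3P[_ no _].
by rewrite in_cons negb_or no xpair_eqE andbF.
Qed.

(** A part m + 1 at the head is overlined or not, whence the factor 2. *)
Lemma size_overparts_le m n :
  size (overparts_le m.+1 n) = size (overparts_le m n) + size (tails m n) * 2.
Proof.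
rewrite muln2 -addnn -{1}(size_map (cons (m.+1, false)) (tails m n)).
rewrite -(size_map (cons (m.+1, true)) (tails m n)) -!size_cat.
apply/perm_size/uniq_perm; first exact: overparts_le_uniq.
  rewrite !cat_uniq overparts_le_uniq !map_cons_uniq ?tails_uniq // andbT /=.
  apply/andP; split; last first.
    by apply/hasPn => _ /mapP[t _ ->]; rewrite mem_map_cons xpair_eqE andbF.
  apply/hasPn => s; rewrite mem_cat => /orP[] /mapP[t _ ->].
    by rewrite overparts_le_notin.
  by rewrite overparts_le_notin.
move=> s; rewrite !mem_cat.
have [sm | sm] := boolP (s \in overparts_le m n).
  by rewrite overparts_le_sub.
apply/idP/idP => /= [sm1 | ].
  have [b [t st]] := overparts_leS sm1 sm; move: sm1.
  rewrite st overparts_le_cons -mem_tails !mem_map_cons !xpair_eqE eqxx => ->.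
  by case: (b).
by case/orP => /mapP[t tt ->]; rewrite overparts_le_cons -mem_tails.
Qed.

Lemma size_overparts_le0 n : size (overparts_le 0 n) = (n == 0).
Proof.
pose only_empty := if n == 0 then [:: [::] : seq (nat * bool)] else [::].
have -> : (n == 0) = size only_empty :> nat by rewrite /only_empty; case: eqP.
rewrite /only_empty.
apply/perm_size/uniq_perm; rewrite ?overparts_le_uniq //; first by case: eqP.
move=> s; rewrite mem_overparts_le; case: s => [|[k b] s]; last first.
  by rewrite overpartition_cons /=; case: k => [|k]; rewrite /= ?andbF; case: (n == 0).
by rewrite /= andbT [_ == n]eq_sym; case: eqP.
Qed.

Lemma overparts_le_max m n : n <= m -> overparts_le m n = overparts n.
Proof.
move=> nm; apply/all_filterP/allP => s; rewrite mem_overparts => /andP[_ /eqP ws].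
apply/allP => x xs; apply: leq_trans nm; rewrite -ws /weight.
elim: s xs {ws} => //= y s IHs; rewrite inE => /predU1P[-> | /IHs]; first exact: leq_addr.
by move/leq_trans; apply; apply: leq_addl.
Qed.

End Enumeration.

(** * The generating function of overpartitions *)

Section GeneratingFunction.
Local Open Scope ring_scope.
Variables (R : comNzRingType) (M : nat).

Definition gf (c : nat -> nat) : {poly R} := \poly_(i < M) (c i)%:R.

Lemma coef_gf c i : (i < M)%N -> (gf c)`_i = (c i)%:R.
Proof. by move=> iM; rewrite coef_poly iM. Qed.

Local Notation G m := (gf (fun n => size (overparts_le m n))).
Local Notation N m := (gf (fun n => size (plain_overparts_le m n))).

Lemma coefXn_gf k c i : (i < M)%N ->
  ('X^k * gf c)`_i = (if (k <= i)%N then c (i - k)%N else 0)%:R.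
Proof.
move=> iM; rewrite coefXnM; case: leqP => // ki.
by rewrite coef_gf //; apply: leq_ltn_trans iM; apply: leq_subr.
Qed.

Lemma agree_plain m : agree M ((1 - 'X^(m.+1)) * N m.+1) (G m).
Proof.
move=> i iM; rewrite mulrBl mul1r coefB coefXn_gf // !coef_gf // -size_tails.
by rewrite size_plain_overparts_le natrD addrK.
Qed.

(** The series N of overpartitions whose parts m + 1 are not overlined
    satisfies (1 - X^(m+1)) N = G m and G (m + 1) = G m + 2 X^(m+1) N;
    eliminate N. *)
Lemma agree_overparts_leS m :
  agree M ((1 - 'X^(m.+1)) * G m.+1) ((1 + 'X^(m.+1)) * G m).
Proof.
have GN : agree M (G m.+1) (G m + 2 * ('X^(m.+1) * N m.+1)).
  move=> i iM; rewrite coefD [2 * _]mulr_natl coefMn coefXn_gf // !coef_gf //.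
  by rewrite -size_tails size_overparts_le natrD natrM mulr_natr.
apply: agree_trans (agreeMl _ GN) _.
have -> : (1 - 'X^(m.+1)) * (G m + 2 * ('X^(m.+1) * N m.+1)) =
  (1 - 'X^(m.+1)) * G m + 2 * 'X^(m.+1) * ((1 - 'X^(m.+1)) * N m.+1) by ring.
have -> : (1 + 'X^(m.+1)) * G m = (1 - 'X^(m.+1)) * G m + 2 * 'X^(m.+1) * G m by ring.
by move=> i iM; rewrite !coefD; congr (_ + _); apply/(agreeMl _ (@agree_plain m)).
Qed.

Lemma agree_overparts_le m : agree M (plain_prod R m * G m) (overlined_prod R m).
Proof.
elim: m => [|m IH].
  rewrite /plain_prod /overlined_prod !big_geq // mul1r => i iM.
  by rewrite coef_gf // size_overparts_le0 coef1.
rewrite /plain_prod /overlined_prod !(@big_nat_recr _ _ _ m.+1) //= -mulrA.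
apply: agree_trans (agreeMl _ (@agree_overparts_leS m)) _.
by rewrite mulrCA [X in agree _ _ X]mulrC; apply: agreeMl.
Qed.

Definition overpartition_gf := gf (fun n => size (overparts n)).

Lemma overlined_prod0 m : (overlined_prod R m)`_0 = 1.
Proof.
rewrite -horner_coef0 horner_prod big_nat big1 // => k /andP[k0 _].
by rewrite hornerE hornerXn hornerC expr0n gtn_eqF ?addr0.
Qed.

Lemma overpartition_gf_theta : agree M (overpartition_gf * theta_sum R M) 1.
Proof.
have gauss : agree M (overlined_prod R M * theta_sum R M) (plain_prod R M).
  exact: agree_weaken (leqnSn M) (@agree_gauss R M).
have GA : agree M (plain_prod R M * overpartition_gf) (overlined_prod R M).
  apply: agree_trans (@agree_overparts_le M) => i iM.
  rewrite !coefM; apply: eq_bigr => j _; rewrite !coef_gf ?overparts_le_max //; lia.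
apply: (agree_cancel (overlined_prod0 M)).
rewrite mulrCA mulr1; apply: agree_trans (agreeMl _ gauss) _.
by rewrite mulrC.
Qed.

Lemma pp_gf n : (n < M)%N -> (overpartition_gf ^+ 2)`_n = (pp n)%:R.
Proof.
move=> nM; rewrite expr2 coefM pp_conv natr_sum; apply: eq_bigr => i _.
by have := ltn_ord i; rewrite natrM => ?; rewrite !coef_gf //; lia.
Qed.

End GeneratingFunction.

(** * The theta series as a sum over the integers *)

Section Theta.
Local Open Scope ring_scope.

Fixpoint int_range (K : nat) : seq int :=
  if K is k.+1 then [:: k.+1%:Z, - k.+1%:Z & int_range k] else [:: 0].

Lemma mem_int_range K x : (x \in int_range K) = (`|x| <= K)%N.
Proof.
elim: K => [|K IH] /=; first by rewrite inE; lia.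
by rewrite !inE IH; lia.
Qed.

Lemma int_range_uniq K : uniq (int_range K).
Proof. by elim: K => //= K ->; rewrite inE !mem_int_range; lia. Qed.

Variable R : comNzRingType.

(** As x^2 has the parity of x, the sign is absorbed in a power of -X; the
    m-th coefficient of a sum of such powers then has sign (-1)^m ([coef_signed_sum]). *)
Lemma theta_sumE K : theta_sum R K = \sum_(x <- int_range K) (- 'X) ^+ (`|x| ^ 2).
Proof.
elim: K => [|K IH]; rewrite /theta_sum.
  by rewrite big_geq //= big_seq1 expr0 addr0.
rewrite (@big_nat_recr _ _ _ K.+1) //= addrA -/(theta_sum R K) IH !big_cons.
rewrite abszN absz_nat.
have -> : (- 'X) ^+ (K.+1 ^ 2) = (-1) ^+ K.+1 * 'X^(K.+1 ^ 2) :> {poly R}.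
  by rewrite (exprNn 'X) -[in LHS]signr_odd oddX -[in RHS]signr_odd.
ring.
Qed.

Lemma coef_signed_sum (T : Type) (s : seq T) (f : T -> nat) m :
  (\sum_(v <- s) (- 'X) ^+ f v : {poly R})`_m
    = (-1) ^+ m * (count (fun v => f v == m) s)%:R.
Proof.
elim: s => [|v s IH]; first by rewrite big_nil coef0 mulr0.
rewrite big_cons coefD IH /= natrD mulrDr; congr (_ + _).
rewrite -scaleN1r exprZn coefZ coefXn eq_sym.
by case: eqP => [-> | _]; rewrite ?mulr0.
Qed.

End Theta.

(** * Integer points of the quadratic forms, modulo 5 *)

Section Lattice.
Local Open Scope ring_scope.

Definition box2 K := [seq (x, y) | x <- int_range K, y <- int_range K].
Definition box3 K := [seq (xy, z) | xy <- box2 K, z <- int_range K].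

Definition norm115 (v : int * int * int) :=
  (`|v.1.1| ^ 2 + `|v.1.2| ^ 2 + 5 * `|v.2| ^ 2)%N.
Definition norm111 (v : int * int * int) :=
  (`|v.1.1| ^ 2 + `|v.1.2| ^ 2 + `|v.2| ^ 2)%N.
Definition norm15 (v : int * int) := (`|v.1| ^ 2 + 5 * `|v.2| ^ 2)%N.

Lemma box2_uniq K : uniq (box2 K).
Proof. by apply: allpairs_uniq; rewrite ?int_range_uniq // => -[? ?] [? ?]. Qed.

Lemma box3_uniq K : uniq (box3 K).
Proof.
by apply: allpairs_uniq; rewrite ?box2_uniq ?int_range_uniq // => -[? ?] [? ?].
Qed.

Lemma mem_box2 K v : (v \in box2 K) = (`|v.1| <= K)%N && (`|v.2| <= K)%N.
Proof.
case: v => x y; rewrite -!mem_int_range.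
apply/allpairsP/andP => [[[a b] /= [aK bK [-> ->]]] // | /= [xK yK]].
by exists (x, y).
Qed.

Lemma mem_box3 K v : (v \in box3 K) =
  [&& `|v.1.1| <= K, `|v.1.2| <= K & `|v.2| <= K]%N.
Proof.
case: v => xy z; rewrite andbA -mem_box2 -mem_int_range.
apply/allpairsP/andP => [[[a b] /= [aK bK [-> ->]]] // | /= [xK yK]].
by exists (xy, z).
Qed.

(** In a box of radius K at least n these are all the integer points, a point
    of norm n having coordinates at most n in absolute value. *)
Definition solutions15 K n := [seq v <- box2 K | norm15 v == n].
Definition solutions111 K n := [seq v <- box3 K | norm111 v == n].
Definition solutions115 K n := [seq v <- box3 K | norm115 v == n].

Lemma absz_sqr_le (x : int) : (`|x| <= `|x| ^ 2)%N.
Proof. by rewrite -mulnn; case: `|x|%N => // k; rewrite leq_pmulr. Qed.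

Lemma mem_solutions15 K n v : (n <= K)%N ->
  (v \in solutions15 K n) = (norm15 v == n).
Proof.
move=> nK; rewrite mem_filter andb_idr // => /eqP vn; rewrite mem_box2.
case: v vn => x y; rewrite /norm15 /=; move: nK (absz_sqr_le x) (absz_sqr_le y).
by move: (absz x) (absz y) (expn `|x| 2) (expn `|y| 2) => a b A B; lia.
Qed.

Lemma mem_solutions111 K n v : (n <= K)%N ->
  (v \in solutions111 K n) = (norm111 v == n).
Proof.
move=> nK; rewrite mem_filter andb_idr // => /eqP vn; rewrite mem_box3.
case: v vn => [[x y] z]; rewrite /norm111 /=.
move: nK (absz_sqr_le x) (absz_sqr_le y) (absz_sqr_le z).
move: (absz x) (absz y) (absz z) (expn `|x| 2) (expn `|y| 2) (expn `|z| 2).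
by move=> a b c A B C; lia.
Qed.

Lemma mem_solutions115 K n v : (n <= K)%N ->
  (v \in solutions115 K n) = (norm115 v == n).
Proof.
move=> nK; rewrite mem_filter andb_idr // => /eqP vn; rewrite mem_box3.
case: v vn => [[x y] z]; rewrite /norm115 /=.
move: nK (absz_sqr_le x) (absz_sqr_le y) (absz_sqr_le z).
move: (absz x) (absz y) (absz z) (expn `|x| 2) (expn `|y| 2) (expn `|z| 2).
by move=> a b c A B C; lia.
Qed.

Lemma absz_sqr (x : int) : (`|x| ^ 2)%N%:Z = x ^+ 2.
Proof. rewrite -mulnn PoszM expr2; lia. Qed.

Lemma norm15E v n : (norm15 v == n) = (v.1 ^+ 2 + 5 * v.2 ^+ 2 == n%:Z).
Proof. by rewrite -!absz_sqr -eqz_nat PoszD PoszM. Qed.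

Lemma norm111E v n :
  (norm111 v == n) = (v.1.1 ^+ 2 + v.1.2 ^+ 2 + v.2 ^+ 2 == n%:Z).
Proof. by rewrite -!absz_sqr -eqz_nat !PoszD. Qed.

Lemma norm115E v n :
  (norm115 v == n) = (v.1.1 ^+ 2 + v.1.2 ^+ 2 + 5 * v.2 ^+ 2 == n%:Z).
Proof. by rewrite -!absz_sqr -eqz_nat !PoszD PoszM. Qed.

Lemma solutions15_uniq K n : uniq (solutions15 K n).
Proof. exact/filter_uniq/box2_uniq. Qed.
Lemma solutions111_uniq K n : uniq (solutions111 K n).
Proof. exact/filter_uniq/box3_uniq. Qed.
Lemma solutions115_uniq K n : uniq (solutions115 K n).
Proof. exact/filter_uniq/box3_uniq. Qed.

Definition reps15 n := size (solutions15 n n).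

Lemma size_solutions15 K n : (n <= K)%N -> size (solutions15 K n) = reps15 n.
Proof.
move=> nK; apply/perm_size/uniq_perm; rewrite ?solutions15_uniq // => v.
by rewrite !mem_solutions15.
Qed.

Lemma dvd5E (x : int) : (5 %| x)%Z = (x%:~R == 0 :> 'F_5).
Proof. exact: (dvdz_pcharf (pchar_Fp (isT : prime 5))). Qed.

Lemma F5_nat0 n : (5 * n)%:R = 0 :> 'F_5.
Proof. by rewrite natrM (pchar_Fp_0 (isT : prime 5)) mul0r. Qed.

Lemma F5_5 : 5%:R = 0 :> 'F_5.
Proof. exact: (pchar_Fp_0 (isT : prime 5)). Qed.

Lemma F5_norm15 v n : norm15 v == n -> v.1%:~R ^+ 2 = n%:R :> 'F_5.
Proof.
rewrite norm15E => /eqP/(congr1 (fun z : int => z%:~R : 'F_5)).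
by rewrite rmorphD rmorphM !rmorphXn /= (F5_5 : 5%:~R = 0) mul0r addr0.
Qed.

Lemma F5_square_values (a : 'F_5) : a ^+ 2 \in [:: 0; 1; 4].
Proof. by case: a => [[|[|[|[|[|a]]]]] lt_a]. Qed.

Lemma reps15_nonresidue n : n%:R = 2 :> 'F_5 \/ n%:R = 3 :> 'F_5 -> reps15 n = 0%N.
Proof.
move=> n5; rewrite /reps15; case E: (solutions15 n n) => [//|v s].
have : v \in solutions15 n n by rewrite E mem_head.
rewrite mem_solutions15 // => /F5_norm15 h; have := F5_square_values v.1%:~R.
by rewrite h; case: n5 => ->.
Qed.

(** If x^2 + 5y^2 = 5n then 5 divides x, and (y, x / 5) has norm n. *)
Lemma reps15_mul5 n : reps15 (5 * n)%N = reps15 n.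
Proof.
rewrite /reps15 -(size_map (fun v : int * int => (5 * v.2, v.1)) (solutions15 n n)).
apply/perm_size/uniq_perm; rewrite ?solutions15_uniq //.
  rewrite map_inj_uniq ?solutions15_uniq // => -[a b] [c d] [? ?]; congr (_, _); lia.
move=> [x y]; rewrite mem_solutions15 //; apply/idP/mapP => [h | [[a b]]]; last first.
  rewrite mem_solutions15 // !norm15E /= => h [-> ->]; nia.
have x5 : (5 %| x)%Z.
  by rewrite dvd5E; move: (F5_norm15 h); rewrite F5_nat0 => /eqP; rewrite expf_eq0.
have xE : x = 5 * (x %/ 5)%Z by lia.
move: (x %/ 5)%Z xE h {x5} => k -> h; exists (y, k) => //.
rewrite mem_solutions15 // norm15E /=; move: h; rewrite norm15E /=; nia.
Qed.

Definition swap12 (v : int * int * int) := (v.1.2, v.1.1, v.2).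
Definition swap23 (v : int * int * int) := (v.1.1, v.2, v.1.2).

(** The points over the isotropic line of F_5^3 spanned by (0, 1, 2).  Its
    images under the permutations of the coordinates are the six isotropic
    lines. *)
Definition on_line (v : int * int * int) :=
  (5 %| v.1.1)%Z && (5 %| v.2 - 2 * v.1.2)%Z.

(** The points over the line are the images of Z^3 under the map
    (a, b, c) |-> (5c, a + 2b, 2a - b), which multiplies a^2 + b^2 + 5c^2
    by 5. *)
Lemma count_on_line K n : (5 * n <= K)%N ->
  count on_line (solutions111 K (5 * n)%N) = size (solutions115 K n).
Proof.
move=> nK; have n_K : (n <= K)%N by lia.
rewrite -size_filter.
rewrite -(size_map (fun v : int * int * int =>
  (5 * v.2, v.1.1 + 2 * v.1.2, 2 * v.1.1 - v.1.2)) (solutions115 K n)).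
apply/perm_size/uniq_perm; first exact/filter_uniq/solutions111_uniq.
  rewrite map_inj_uniq ?solutions115_uniq //.
  by move=> [[a b] c] [[a' b'] c'] [? ? ?]; congr (_, _, _); lia.
move=> [[x y] z]; rewrite mem_filter mem_solutions111 //.
apply/andP/mapP => [[/andP[/= x5 zy5]] | [[[a b] c]]]; last first.
  rewrite mem_solutions115 // norm115E norm111E /on_line /= => h [-> -> ->].
  split; [lia | nia].
rewrite norm111E /= => h.
have xE : x = 5 * (x %/ 5)%Z by lia.
have zE : z = 2 * y + 5 * ((z - 2 * y) %/ 5)%Z by lia.
move: (x %/ 5)%Z ((z - 2 * y) %/ 5)%Z xE zE h => c k -> -> h.
(* The system a + 2b = y, 2a - b = 2y + 5k has this integral solution. *)
move=> {x5 zy5}; exists (y + 2 * k, - k, c); last by congr (_, _, _) => /=; lia.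
rewrite mem_solutions115 // norm115E /=; move: h; nia.
Qed.

Lemma count_symmetry K n f (P : pred (int * int * int)) : (n <= K)%N ->
  involutive f -> (forall v, norm111 (f v) = norm111 v) ->
  count (P \o f) (solutions111 K n) = count P (solutions111 K n).
Proof.
move=> nK fK f_norm; rewrite -count_map; apply/permP/uniq_perm.
- by rewrite map_inj_uniq ?solutions111_uniq //; apply: inv_inj.
- exact: solutions111_uniq.
move=> v; rewrite -{1}(fK v) mem_map; last exact: inv_inj.
by rewrite !mem_solutions111 // f_norm.
Qed.

Lemma count_swap12 K n (P : pred (int * int * int)) : (n <= K)%N ->
  count (P \o swap12) (solutions111 K n) = count P (solutions111 K n).
Proof.
move=> nK; apply: count_symmetry => // [[[x y] z] // | v].
by rewrite /norm111 (addnC (expn _ 2)).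
Qed.

Lemma count_swap23 K n (P : pred (int * int * int)) : (n <= K)%N ->
  count (P \o swap23) (solutions111 K n) = count P (solutions111 K n).
Proof.
move=> nK; apply: count_symmetry => // [[[x y] z] // | v].
by rewrite /norm111 addnAC.
Qed.

(** A nonzero isotropic vector lies on exactly one of the six lines and the
    zero vector on all six; 1 and 6 are equal modulo 5. *)
Lemma F5_lines (a b c : 'F_5) : a ^+ 2 + b ^+ 2 + c ^+ 2 == 0 ->
  let l (a b c : 'F_5) := (a == 0) && (c == 2 * b) in
  (l a b c + l a c b + l b a c + l b c a + l c a b + l c b a)%:R = 1 :> 'F_5.
Proof.
case: a => [[|[|[|[|[|a]]]]] lt_a] //; case: b => [[|[|[|[|[|b]]]]] lt_b] //;
  case: c => [[|[|[|[|[|c]]]]] lt_c] //.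
all: by move=> ?; apply/eqP.
Qed.

Lemma on_lineE v :
  on_line v = (v.1.1%:~R == 0 :> 'F_5) && (v.2%:~R == 2 * v.1.2%:~R :> 'F_5).
Proof. by rewrite /on_line !dvd5E rmorphB rmorphM subr_eq0. Qed.

(** Sum, over the points of x^2 + y^2 + z^2 = 5n, the number of lines that
    each point lies over: every point contributes 1 modulo 5, and every line
    contributes the same count, because permuting coordinates preserves the
    equation. *)
Lemma size_solutions111_mod5 K n : (5 * n <= K)%N ->
  (size (solutions111 K (5 * n)%N))%:R = (size (solutions115 K n))%:R :> 'F_5.
Proof.
move=> nK; rewrite -count_on_line //; set s := solutions111 _ _.
pose s1 := on_line \o swap12; pose s2 := on_line \o swap23.
have eqs : (count on_line s + count s2 s + count s1 s + count (s2 \o swap12) s +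
   count (s1 \o swap23) s + count (s2 \o swap12 \o swap23) s = 6 * count on_line s)%N.
  rewrite /s1 /s2 !(count_swap12, count_swap23) // -/s; lia.
transitivity ((6 * count on_line s)%:R : 'F_5); last first.
  by rewrite natrM (_ : 6%:R = 1 :> 'F_5) ?mul1r //; apply/eqP.
rewrite -eqs -sum1_size natr_sum -!sum1_count.
rewrite !(big_mkcond _ (fun _ => 1%N)) /= -!big_split natr_sum /=.
rewrite big_seq [RHS]big_seq; apply: eq_bigr => -[[x y] z].
rewrite mem_solutions111 // norm111E /= => /eqP v5.
have /F5_lines lines : x%:~R ^+ 2 + y%:~R ^+ 2 + z%:~R ^+ 2 == 0 :> 'F_5.
  by rewrite -!rmorphXn -!rmorphD /= v5 (F5_nat0 n : (5 * n)%N%:~R = 0).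
by rewrite /s1 /s2 /= !on_lineE; apply: esym lines.
Qed.

End Lattice.

(** * Coefficients of index divisible by 5 *)

Section FiveDissection.
Local Open Scope ring_scope.

Lemma Frobenius_polyF5 (p : {poly 'F_5}) : p ^+ 5 = p \Po 'X^5.
Proof.
have ch : 5%N \in [pchar {poly 'F_5}] by rewrite pchar_poly (pchar_Fp (isT : prime 5)).
elim/poly_ind: p => [|p c IH]; first by rewrite expr0n comp_poly0.
rewrite -(pFrobenius_autE ch) rmorphD rmorphM /= !pFrobenius_autE IH.
rewrite comp_polyD comp_polyM comp_polyX comp_polyC -polyC_exp; congr (_ + _%:P).
by apply/eqP; case: c => [[|[|[|[|[|c]]]]] lt_c].
Qed.

Variable R : comNzRingType.
Implicit Types p q : {poly R}.

Definition U5 p : {poly R} := \poly_(i < size p) p`_(5 * i)%N.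

Lemma coef_U5 p i : (U5 p)`_i = p`_(5 * i)%N.
Proof.
rewrite coef_poly; case: ltnP => // le_i; rewrite nth_default //.
by apply: leq_trans le_i _; rewrite leq_pmull.
Qed.

Lemma U5_comp p q : U5 (p * (q \Po 'X^5)) = U5 p * q.
Proof.
elim/poly_ind: q p => [|q c IH] p.
  by rewrite comp_poly0 !mulr0; apply/polyP => i; rewrite coef_U5 !coef0.
rewrite comp_polyD comp_polyM comp_polyX comp_polyC !mulrDr.
rewrite (mulrA p) (mulrA (U5 p) q).
apply/polyP => i; rewrite coef_U5 !coefD !coefMC coef_U5; congr (_ + _).
rewrite coefMXn coefMX; case: i => [|i] //=.
by rewrite -IH coef_U5 mulnS addKn.
Qed.

(** The last index read is 5 (N - 1), which must be less than M. *)
Lemma agree_U5 M N p q : (5 * N <= M.+4)%N -> agree M p q -> agree N (U5 p) (U5 q).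
Proof. by move=> NM pq i iN; rewrite !coef_U5 pq //; lia. Qed.

End FiveDissection.

(** * Overpartition pairs modulo 5 *)

Section ThetaCoefficients.
Local Open Scope ring_scope.
Variable R : comNzRingType.

Local Notation T K := (theta_sum R K).

Lemma coef_theta3 K m :
  (T K ^+ 3)`_m = (-1) ^+ m * (size (solutions111 K m))%:R.
Proof.
rewrite size_filter -coef_signed_sum; congr (polyseq _)`_m.
rewrite /box3 /box2 !big_allpairs_dep /= exprSr expr2 !theta_sumE.
rewrite big_distrlr /= mulr_suml; apply: eq_bigr => x _ /=.
rewrite mulr_suml; apply: eq_bigr => y _ /=.
by rewrite mulr_sumr; apply: eq_bigr => z _; rewrite /norm111 /= !exprD.
Qed.

Lemma theta_sum_comp5 K :
  T K \Po 'X^5 = \sum_(x <- int_range K) (- 'X) ^+ (5 * `|x| ^ 2).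
Proof.
rewrite theta_sumE raddf_sum; apply: eq_bigr => x _ /=.
rewrite rmorphXn rmorphN /= comp_polyX exprM; congr (_ ^+ _); ring.
Qed.

Lemma coef_theta2_theta5 K m :
  (T K ^+ 2 * (T K \Po 'X^5))`_m = (-1) ^+ m * (size (solutions115 K m))%:R.
Proof.
rewrite size_filter -coef_signed_sum; congr (polyseq _)`_m.
rewrite /box3 /box2 !big_allpairs_dep /= expr2 theta_sum_comp5 !theta_sumE.
rewrite big_distrlr /= mulr_suml; apply: eq_bigr => x _ /=.
rewrite mulr_suml; apply: eq_bigr => y _ /=.
by rewrite mulr_sumr; apply: eq_bigr => z _; rewrite /norm115 /= !exprD.
Qed.

Lemma coef_theta_theta5 K m :
  (T K * (T K \Po 'X^5))`_m = (-1) ^+ m * (size (solutions15 K m))%:R.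
Proof.
rewrite size_filter -coef_signed_sum; congr (polyseq _)`_m.
rewrite /box2 !big_allpairs_dep /= theta_sum_comp5 !theta_sumE.
rewrite mulr_suml; apply: eq_bigr => x _ /=.
by rewrite mulr_sumr; apply: eq_bigr => z _; rewrite /norm15 /= !exprD.
Qed.

End ThetaCoefficients.

Section Main.
Local Open Scope ring_scope.

Local Notation T K := (theta_sum 'F_5 K).

Lemma U5_theta3 N K : (5 * N <= K.+4)%N ->
  agree N (U5 (T K ^+ 3)) (T K ^+ 2 * (T K \Po 'X^5)).
Proof.
move=> NK i iN; rewrite coef_U5 coef_theta3 coef_theta2_theta5.
rewrite size_solutions111_mod5; last by lia.
by rewrite -signr_odd oddM signr_odd.
Qed.

(** From A^2 T^5 = T^3, applying [U5] gives U(A^2) T = T^2 T(X^5);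
    multiplying by A, the inverse of T, yields U(A^2) = T T(X^5). *)
Lemma pp5 n : (pp (5 * n)%N)%:R = (-1) ^+ n * (reps15 n)%:R :> 'F_5.
Proof.
pose K := (5 * n)%N.+1; pose A := overpartition_gf 'F_5 K.
have AT : agree K (A * T K) 1 := @overpartition_gf_theta 'F_5 K.
have AT' : agree n.+1 (A * T K) 1 by apply: agree_weaken AT; rewrite /K; lia.
have le_nK : (5 * n.+1 <= K.+4)%N by rewrite /K; lia.
have UA : agree n.+1 (U5 (A ^+ 2) * T K) (T K * (T K * (T K \Po 'X^5))).
  rewrite -U5_comp -[X in U5 (_ * X)]Frobenius_polyF5 [X in agree _ _ X]mulrA -expr2.
  apply: agree_trans (U5_theta3 le_nK); apply: agree_U5 le_nK _.
  have -> : A ^+ 2 * T K ^+ 5 = (A * T K) * ((A * T K) * T K ^+ 3) by ring.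
  rewrite -[X in agree _ _ X]mul1r; apply: agreeM => //.
  by rewrite -[X in agree _ _ X]mul1r; apply: agreeM.
have UA' : agree n.+1 (U5 (A ^+ 2)) (T K * (T K \Po 'X^5)).
  apply: (agree_trans (q := A * (U5 (A ^+ 2) * T K))).
    rewrite mulrCA -[X in agree _ X _]mulr1; apply: agreeMl; exact: agree_sym.
  apply: agree_trans (agreeMl A UA) _.
  by rewrite mulrA -[X in agree _ _ X]mul1r; apply: agreeMr.
rewrite -(@pp_gf _ K) ?/K // -coef_U5 UA' // coef_theta_theta5 size_solutions15 //; lia.
Qed.

Lemma reps15_pow5 a m : reps15 (5 ^ a * m)%N = reps15 m.
Proof. by elim: a => [|a IH]; rewrite ?mul1n // expnS -mulnA reps15_mul5. Qed.

Lemma pp_nonresidue a m : m%:R = 2 :> 'F_5 \/ m%:R = 3 :> 'F_5 ->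
  pp (5 ^ a.+1 * m)%N = 0 %[mod 5].
Proof.
move=> m5; apply/eqP; rewrite eqn_mod_dvd // subn0.
rewrite (dvdn_pcharf (pchar_Fp (isT : prime 5))) expnS -mulnA pp5 reps15_pow5.
by rewrite reps15_nonresidue // mulr0.
Qed.

End Main.

Theorem theorem4p5 (alpha n : nat) (halpha : 1 <= alpha) :
  pp (5 ^ alpha * (5 * n + 2)) = 0 %[mod 5] /\
  pp (5 ^ alpha * (5 * n + 3)) = 0 %[mod 5].
Proof.
case: alpha halpha => // a _; split; apply: pp_nonresidue; rewrite natrD F5_nat0 add0r.
  by left.
by right.
Qed.
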